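(* Let $n\ge1$, let $F:\mathbb{R}^{n+1}\to\mathbb{R}$ be an elliptic integrand of class $C^{1,1}$, and let $A\subseteq\mathbb{R}^{n+1}$ be closed. Let $r>0$ and suppose that for every $\mathcal{H}^n$-measurable bounded function $f:\mathbb{R}^{n+1}\times\partial\mathbf{U}^{F^*}(0,1)\to\mathbb{R}$ with compact support there are numbers $c_1(f),\ldots,c_{n+1}(f)\in\mathbb{R}$ such that $$\int_{\mathbb{R}^{n+1}\setminus A}f(\boldsymbol\psi^F_A(x))\,\mathbf{1}_{\{y:\boldsymbol\delta^F_A(y)\le t\}}(x)\,d\mathcal{L}^{n+1}(x)=\sum_{j=1}^{n+1}c_j(f)\,t^{j}\qquad\text{for }0<t<r.$$ Then $\operatorname{reach}^F(A)\ge r$.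
   Context: An integrand of class $C^{k,\alpha}$ is a non-negative function $F:\mathbb{R}^{n+1}\to\mathbb{R}$ with $F|_{\mathbb{R}^{n+1}\setminus\{0\}}$ of class $C^{k,\alpha}$ and $F(\lambda\nu)=|\lambda|F(\nu)$ for all $\lambda\in\mathbb{R}$, $\nu\in\mathbb{R}^{n+1}$. $F$ is elliptic if there is $\gamma>0$ such that $u\mapsto F(u)-\gamma|u|$ is convex. The conjugate norm is $F^{*}(w)=\sup\{w\bullet u:F(u)\le1\}$, and $\mathbf{U}^{F^*}(x,r)=\{y:F^*(y-x)<r\}$. $\boldsymbol\delta^F_A(x)=\inf\{F^*(a-x):a\in A\}$. The anisotropic nearest point projection $\boldsymbol\xi^F_A$ has as domain $\operatorname{dmn}\boldsymbol\xi^F_A$ the set of $x\in\mathbb{R}^{n+1}$ for which there is a unique $a\in A$ with $F^*(x-a)=\boldsymbol\delta^F_A(x)$, and $\boldsymbol\xi^F_A(x)=a$. For $z\in\operatorname{dmn}\boldsymbol\xi^F_A\setminus A$: $\boldsymbol\nu^F_A(z)=\boldsymbol\delta^F_A(z)^{-1}(z-\boldsymbol\xi^F_A(z))$ and $\boldsymbol\psi^F_A(z)=(\boldsymbol\xi^F_A(z),\boldsymbol\nu^F_A(z))\in A\times\partial\mathbf{U}^{F^*}(0,1)$; the complement of $\operatorname{dmn}\boldsymbol\xi^F_A$ is $\mathcal{L}^{n+1}$-null, so $\boldsymbol\psi^F_A$ is defined a.e. on $\mathbb{R}^{n+1}\setminus A$. $\operatorname{reach}^F(A)=\sup\{\rho:\{x:\boldsymbol\delta^F_A(x)<\rho\}\subseteq\operatorname{dmn}\boldsymbol\xi^F_A\}$.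 *)

(* Defs.v *)
From HB Require Import structures.
From mathcomp Require Import all_boot all_order all_algebra.
From mathcomp Require Import all_classical all_reals all_analysis.
Import Order.TTheory GRing.Theory Num.Theory.
Import numFieldNormedType.Exports.

Set Implicit Arguments.
Unset Strict Implicit.
Unset Printing Implicit Defensive.

Local Open Scope classical_set_scope.
Local Open Scope ring_scope.

Section EuclideanSpace.
Context {R : realType} {n : nat}.
Implicit Types u v : 'rV[R]_n.

(* The library norm on ['rV_n] is the sup norm. *)
Definition dotv u v : R := \sum_(i < n) u ord0 i * v ord0 i.

Definition enorm u : R := Num.sqrt (dotv u u).

Definition edist2 (p q : 'rV[R]_n * 'rV[R]_n) : R :=
  Num.sqrt (enorm (p.1 - q.1) ^+ 2 + enorm (p.2 - q.2) ^+ 2).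

End EuclideanSpace.

Definition frontier {T : topologicalType} (E : set T) : set T :=
  closure E `\` E°.

Section CoverOuterMeasure.
Local Open Scope ereal_scope.
Context {R : realType} {T I : Type} (E : I -> set T) (g : I -> \bar R).

Definition cover_outer (X : set T) : \bar R :=
  ereal_inf [set \sum_(k <oo) g (s k) |
    s in [set s : nat -> I | X `<=` \bigcup_k E (s k)]].

Hypothesis g_ge0 : forall i, 0 <= g i.

Lemma cover_outer_ge0 X : 0 <= cover_outer X.
Proof. by apply: le_ereal_inf_tmp => _ [s _ <-]; exact: nneseries_ge0. Qed.

Lemma le_cover_outer : {homo cover_outer : A B / A `<=` B >-> A <= B}.
Proof.
move=> A B AB; apply: ereal_inf_le_tmp => _ [s Bs <-].
by exists s => //; exact: subset_trans AB Bs.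
Qed.

Lemma cover_outer0 : (exists i, g i = 0) -> cover_outer set0 = 0.
Proof.
move=> [i gi0]; apply/eqP; rewrite eq_le cover_outer_ge0 andbT.
apply: ereal_inf_lbound; exists (fun=> i) => //=.
by apply: eseries0 => k _ _; exact: gi0.
Qed.

Lemma cover_outer_sigma_subadditive : sigma_subadditive cover_outer.
Proof.
move=> A; have [[i ioo]|] := pselect (exists i, cover_outer (A i) = +oo).
  rewrite (eseries_pinfty _ _ ioo) ?leey// => k _.
  by rewrite -ltNye (lt_le_trans _ (cover_outer_ge0 _)).
rewrite -forallNE => Aoo.
suff add2e (e : {posnum R}) : cover_outer (\bigcup_k A k) <=
    \sum_(i <oo) cover_outer (A i) + e%:num%:E.
  by apply/lee_addgt0Pr => _/posnumP[].
rewrite (le_trans _ (epsilon_trick _ _ _))//; last first.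
  by move=> k; exact: cover_outer_ge0.
pose P k (s : nat -> I) := A k `<=` \bigcup_j E (s j) /\
  \sum_(j <oo) g (s j) <= cover_outer (A k) + (e%:num / (2 ^ k.+1)%:R)%:E.
have [G PG] : {G : nat -> nat -> I & forall k, P k (G k)}.
  apply: (@choice _ _ P) => k; rewrite /P /cover_outer.
  set S := (X in ereal_inf X); move infS : (ereal_inf S) => iS.
  case: iS infS => [r Sr|Soo|Soo].
  - have en1 : (0 < e%:num / (2 ^ k.+1)%:R)%R by [].
    have /(lb_ereal_inf_adherent en1) : ereal_inf S \is a fin_num by rewrite Sr.
    by move=> [x [s As <-] xS]; exists s; split => //; rewrite -Sr; exact/ltW.
  - by have := Aoo k; rewrite /cover_outer Soo.
  - suff : lbound S 0 by move/le_ereal_inf_tmp; rewrite Soo.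
    by move=> /= _ [s _ <-]; exact: nneseries_ge0.
have gG_ge0 x : 0 <= (g \o uncurry G) x by exact: g_ge0.
apply: (@le_trans _ _ (\esum_(i in setT) (g \o uncurry G) i)).
  apply: ereal_inf_lbound => /=.
  have /card_esym/ppcard_eqP[f] := card_nat2.
  exists (uncurry G \o f).
    move=> t [i _] /(PG i).1[j _ Eij].
    by exists (f^-1%FUN (i, j)) => //=; rewrite invK ?inE.
  rewrite -(esum_pred_image (g \o uncurry G) _ xpredT) ?[fun=> _]set_true//.
  by rewrite image_eq.
rewrite (_ : esum _ _ = \sum_(i <oo) \sum_(j <oo) g (G i j)); last first.
  pose J : nat -> set (nat * nat) := fun i => [set (i, j) | j in setT].
  rewrite (_ : setT = \bigcup_k J k); last first.
    by rewrite predeqE => -[a b]; split => // _; exists a => //; exists b.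
  rewrite esum_bigcupT /=; last 2 first.
    - apply/trivIsetP => i j _ _ ij.
      rewrite predeqE => -[p m] /=; split => //= -[] [_] _ [<-{p} _].
      by move=> [m' _] [] /esym/eqP; rewrite (negbTE ij).
    - by move=> /= [p m]; exact: g_ge0.
  rewrite -(image_id [set: nat]) -fun_true esum_pred_image//; last first.
    by move=> k _; exact: esum_ge0.
  apply: eq_eseriesr => /= j _.
  rewrite -(esum_pred_image (g \o uncurry G) (pair j) predT)//=; last first.
    by move=> ? ? _ _; exact: (@can_inj _ _ _ snd).
  by congr esum; rewrite predeqE => -[a b]; split; move=> [i _ <-]; exists i.
apply: lee_lim.
- apply: is_cvg_nneseries => k *.
  by apply: nneseries_ge0 => m *; exact: (gG_ge0 (k, m)).
- apply: is_cvg_nneseries => k *; apply: adde_ge0 => //.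
  exact: cover_outer_ge0.
- by near=> k; apply: lee_sum => i _; exact: (PG i).2.
Unshelve. all: by end_near. Qed.

End CoverOuterMeasure.

Section LebesgueMeasure.
Local Open Scope ereal_scope.
Context (R : realType) (n : nat).

Definition box (ab : 'rV[R]_n.+1 * 'rV[R]_n.+1) : set 'rV[R]_n.+1 :=
  [set x | forall i, (ab.1 ord0 i < x ord0 i <= ab.2 ord0 i)%R].

Definition box_volume (ab : 'rV[R]_n.+1 * 'rV[R]_n.+1) : \bar R :=
  (\prod_(i < n.+1) Num.max 0 (ab.2 ord0 i - ab.1 ord0 i))%:E.

Definition lebesgue_outer : set 'rV[R]_n.+1 -> \bar R :=
  cover_outer box box_volume.

Let box_volume_ge0 ab : 0 <= box_volume ab.
Proof. by rewrite lee_fin; apply: prodr_ge0 => i _; rewrite le_max lexx. Qed.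

Let box_volume0 : exists ab, box_volume ab = 0.
Proof.
exists (0, 0)%R; rewrite /box_volume big_ord_recl.
by rewrite subrr maxxx mul0r.
Qed.

HB.instance Definition _ := isOuterMeasure.Build R 'rV[R]_n.+1 lebesgue_outer
  (@cover_outer0 _ _ _ box _ box_volume_ge0 box_volume0)
  (@cover_outer_ge0 _ _ _ box _ box_volume_ge0)
  (@le_cover_outer _ _ _ box box_volume)
  (@cover_outer_sigma_subadditive _ _ _ box _ box_volume_ge0).

(* [caratheodory_type] carries the sigma-algebra of Lebesgue measurable sets,
   on which the measure is complete. *)
Definition lebesgue : set (caratheodory_type lebesgue_outer) -> \bar R :=
  lebesgue_outer.

HB.instance Definition _ := isMeasure.Build _ _ _ lebesgue
  (@caratheodory_measure0 _ _ lebesgue_outer)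
  (@caratheodory_measure_ge0 _ _ lebesgue_outer)
  (@caratheodory_measure_sigma_additive _ _ lebesgue_outer).

End LebesgueMeasure.

Arguments lebesgue R n _ : clear implicits.

Section HausdorffMeasure.
Context {R : realType} {T : Type}.

(* Volume of the Euclidean unit ball of dimension [k], through the recursion
   omega_(k+2) = 2 pi / (k + 2) * omega_k. *)
Fixpoint unit_ball_volume (k : nat) : R :=
  match k with
  | 0 => 1
  | 1 => 2
  | k'.+2 => 2 * pi / k'.+2%:R * unit_ball_volume k'
  end.

Context (d : T -> T -> R).

Definition diam (X : set T) : \bar R :=
  Order.max 0%E (ereal_sup [set (d z.1 z.2)%:E | z in X `*` X]).

(* The case distinction only matters for [k = 0], where [0 ^+ 0 = 1]. *)
Definition hausdorff_gauge (k : nat) (X : set T) : \bar R :=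
  if X == set0 then 0%E
  else (unit_ball_volume k * (fine (diam X) / 2) ^+ k)%:E.

Definition hausdorff_size (k : nat) (delta : R) (X : set T) : \bar R :=
  ereal_inf [set (\sum_(j <oo) hausdorff_gauge k (E j))%E |
    E in [set E : (set T)^nat |
      X `<=` \bigcup_j E j /\ forall j, (diam (E j) <= delta%:E)%E]].

Definition hausdorff (k : nat) (X : set T) : \bar R :=
  ereal_sup [set hausdorff_size k delta X | delta in [set delta : R | 0 < delta]].

End HausdorffMeasure.

Section Integrands.
Context {R : realType} {n : nat}.
Local Notation V := 'rV[R]_n.
Implicit Types F : V -> R.

(* Class [C^{1,1}] on an open set [U]: the derivative is locally Lipschitz
   (in operator norm), hence continuous. *)
Definition class_C11 (U : set V) F : Prop :=
  forall x, U x -> differentiable (F : V -> R^o) x /\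
    exists L : R, exists2 W : set V, nbhs x W &
      forall y z, (W `&` U) y -> (W `&` U) z -> forall v : V,
        `| 'd (F : V -> R^o) y v - 'd (F : V -> R^o) z v |
          <= L * enorm (y - z) * enorm v.

Definition integrand_C11 F : Prop :=
  [/\ forall u, 0 <= F u,
      forall (l : R) u, F (l *: u) = `|l| * F u &
      class_C11 [set~ 0] F].

Definition elliptic F : Prop :=
  exists2 gamma : R, 0 < gamma &
    convex_function [set: V] (fun u : V => F u - gamma * enorm u).

Definition conjugate F (w : V) : R :=
  sup [set dotv w u | u in [set u | F u <= 1]].

Definition wulff F (x : V) (r : R) : set V := [set y | conjugate F (y - x) < r].

Section Projection.
Context (F : V -> R) (A : set V).

(* Equal to [+oo] when [A] is empty. *)
Definition adist (x : V) : \bar R :=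
  ereal_inf [set (conjugate F (a - x))%:E | a in A].

Definition nearest (x : V) : set V :=
  [set a | A a /\ (conjugate F (x - a))%:E = adist x].

Definition dmn_proj : set V := [set x | exists! a, nearest x a].

(* Meaningful on [dmn_proj] only. *)
Definition aproj (x : V) : V := xget 0 (nearest x).

Definition anormal (z : V) : V := (fine (adist z))^-1 *: (z - aproj z).

Definition apsi (z : V) : V * V := (aproj z, anormal z).

Definition areach : \bar R :=
  ereal_sup [set rho%:E | rho in
    [set rho : R | [set x | (adist x < rho%:E)%E] `<=` dmn_proj]].

End Projection.

End Integrands.

(* A function on the closed set [S] is represented by a function on the ambient
   space; its values off [S] are never constrained. *)
Section FunctionsOnSubset.
Context {R : realType} {T : topologicalType}.
Implicit Types (S : set T) (f : T -> R).

Definition outer_measurable_on (mu : set T -> \bar R) S f : Prop :=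
  forall Y : set R, measurable Y -> mu.-caratheodory (S `&` f @^-1` Y).

Definition bounded_values_on S f : Prop :=
  exists M : R, forall z, S z -> `|f z| <= M.

Definition compact_support_on S f : Prop :=
  compact (closure (S `&` [set z | f z != 0])).

End FunctionsOnSubset.

(* Main.v *)
Require Import Defs.
From HB Require Import structures.
From mathcomp Require Import all_boot all_order all_algebra.
From mathcomp Require Import all_classical all_reals all_analysis.
From mathcomp Require Import measurable_realfun.
From mathcomp Require Import ring lra zify.
Import Order.TTheory GRing.Theory Num.Theory.
Import numFieldNormedType.Exports.
Set Implicit Arguments.
Unset Strict Implicit.
Unset Printing Implicit Defensive.
Local Open Scope classical_set_scope.
Local Open Scope ring_scope.

(* Fix x0 outside A with F*-distance d(x0) < s < r, and test the polynomial
   formula on the indicator f of the (bounded) set of pairs (a, eta) with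
   d(a + s eta) < s. If d(x) >= s then psi(x) is not such a pair, so the left-hand
   side does not depend on t in [s, r); a polynomial without constant term that
   is constant on an interval is zero. Hence points arbitrarily near x0 lie on a
   ray a + t eta with d(a + s eta) = s. Such rays form a closed set, so x0
   lies on one, and since F is differentiable away from 0 the norm F* is strictly
   convex, which makes the foot a of that ray the only nearest point of x0. *)

(** * Hausdorff measures *)

(** Both measures are built from covers. The test function must be measurable for H^n: a Lipschitz
    form of Caratheodory's criterion yields this, because the set of pairs is the positivity set of
    a Lipschitz function. On the Lebesgue side it is enough that boxes are measurable and have at
    least their elementary volume, so a zero integral excludes every nondegenerate box on which the
    integrand is at least 1. The bound [K] on the foot points serves twice: it makes the support of
    the test function compact, and it makes the set of rays of length [s] compact, so that their
    union is closed. The strict inequality d(x0) < s puts x0 strictly before the end of its ray; at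
    the end itself, uniqueness of the nearest point may fail. *)

Section HausdorffOuterMeasure.
Local Open Scope ereal_scope.
Context (R : realType) (T : Type) (d : T -> T -> R) (k : nat).

Lemma unit_ball_volume_ge0 (j : nat) : (0 <= unit_ball_volume j :> R)%R.
Proof.
suff: (0 <= unit_ball_volume j :> R)%R /\ (0 <= unit_ball_volume j.+1 :> R)%R.
  by case.
elim: j => [|j [IH1 IH2]]; first by split => /=; lra.
split => //; rewrite [unit_ball_volume _]/=.
by rewrite mulr_ge0// divr_ge0// mulr_ge0// pi_ge0.
Qed.

Lemma diam_ge0 (X : set T) : 0 <= diam d X.
Proof. by rewrite /diam le_max lexx. Qed.

Lemma hausdorff_gauge_ge0 (X : set T) : 0 <= hausdorff_gauge d k X.
Proof.
rewrite /hausdorff_gauge; case: ifP => // _; rewrite lee_fin mulr_ge0//.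
  exact: unit_ball_volume_ge0.
by rewrite exprn_ge0// divr_ge0// fine_ge0// diam_ge0.
Qed.

Lemma hausdorff_gauge0 : hausdorff_gauge d k set0 = 0.
Proof. by rewrite /hausdorff_gauge eqxx. Qed.

Lemma diam0 : diam d set0 = 0.
Proof.
rewrite /diam set0X image_set0 ereal_sup0; exact/max_idPl/leNye.
Qed.

(** Moving the diameter bound into the index type turns the size at scale [delta] into an instance
    of [cover_outer], so that its lemmas apply. *)
Lemma hausdorff_sizeE (delta : R) (X : set T) :
  hausdorff_size d k delta X =
  cover_outer (fun E : {E : set T | diam d E <= delta%:E} => sval E)
              (fun E => hausdorff_gauge d k (sval E)) X.
Proof.
rewrite /hausdorff_size /cover_outer; congr ereal_inf.
apply/seteqP; split => z.
  move=> [E [XE dE] <-].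
  by exists (fun j => exist (fun E : set T => diam d E <= delta%:E) (E j) (dE j)).
move=> [s Xs <-]; exists (fun j => sval (s j)) => //; split=> // j.
exact: (svalP (s j)).
Qed.

Lemma hausdorff_size_ge0 delta X : 0 <= hausdorff_size d k delta X.
Proof.
rewrite hausdorff_sizeE; apply: cover_outer_ge0 => i.
exact: hausdorff_gauge_ge0.
Qed.

Lemma hausdorff_size_le delta X : (0 < delta)%R ->
  hausdorff_size d k delta X <= hausdorff d k X.
Proof. by move=> d0; apply: ereal_sup_ubound; exists delta. Qed.

Lemma hausdorff_ge0 X : 0 <= hausdorff d k X.
Proof.
apply: le_trans (hausdorff_size_le X ltr01); exact: hausdorff_size_ge0.
Qed.

Lemma le_hausdorff : {homo hausdorff d k : A B / A `<=` B >-> A <= B}.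
Proof.
move=> X Y XY; apply: ge_ereal_sup => _ [delta d0 <-].
apply: le_trans (hausdorff_size_le Y d0).
by rewrite !hausdorff_sizeE; apply: le_cover_outer.
Qed.

Lemma hausdorff0 : hausdorff d k set0 = 0.
Proof.
apply/eqP; rewrite eq_le hausdorff_ge0 andbT.
apply: ge_ereal_sup => _ [delta /ltW d0 <-]; rewrite hausdorff_sizeE.
rewrite cover_outer0// => [i|]; first exact: hausdorff_gauge_ge0.
have dd : diam d set0 <= delta%:E by rewrite diam0.
exists (exist (fun E : set T => diam d E <= delta%:E) set0 dd).
exact: hausdorff_gauge0.
Qed.

Lemma hausdorff_sigma_subadditive : sigma_subadditive (hausdorff d k).
Proof.
move=> X; apply: ge_ereal_sup => _ [delta d0 <-]; rewrite hausdorff_sizeE.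
apply: le_trans (cover_outer_sigma_subadditive _ _ _) _.
  by move=> i; exact: hausdorff_gauge_ge0.
apply: lee_nneseries => [i _ _|i _].
  by apply: cover_outer_ge0 => j; exact: hausdorff_gauge_ge0.
by rewrite -hausdorff_sizeE; exact: hausdorff_size_le.
Qed.

HB.instance Definition _ := isOuterMeasure.Build R T (hausdorff d k)
  hausdorff0 hausdorff_ge0 le_hausdorff hausdorff_sigma_subadditive.

Lemma hausdorff_size_anti (e1 e2 : R) X : (e1 <= e2)%R ->
  hausdorff_size d k e2 X <= hausdorff_size d k e1 X.
Proof.
move=> e12; apply: ereal_inf_le_tmp => _ [E [XE dE] <-]; exists E => //.
by split=> // j; rewrite (le_trans (dE j))// lee_fin.
Qed.

(** A piece of diameter at most [e] cannot meet both sets, so a fine enough cover of the union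
    splits into a cover of [P] and one of [Q] with no piece used twice. *)
Lemma hausdorff_separated (P Q : set T) (e : R) : (0 < e)%R ->
  (forall x y, P x -> Q y -> (e < d x y)%R) ->
  hausdorff d k P + hausdorff d k Q <= hausdorff d k (P `|` Q).
Proof.
move=> e0 PQ.
have sz (delta : R) : (0 < delta <= e)%R ->
    hausdorff_size d k delta P + hausdorff_size d k delta Q <=
    hausdorff_size d k delta (P `|` Q).
  move=> /andP[d0 de]; apply: le_ereal_inf_tmp => _ [E [PQE dE] <-].
  pose cut (Z : set T) j := if E j `&` Z == set0 then set0 else E j.
  have cut_size Z : Z `<=` P `|` Q ->
      hausdorff_size d k delta Z <= \sum_(j <oo) hausdorff_gauge d k (cut Z j).
    move=> ZPQ; apply: ereal_inf_lbound; exists (cut Z) => //; split.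
      move=> x Zx; have [j _ Ejx] := PQE _ (ZPQ _ Zx); exists j => //.
      rewrite /cut; case: eqP => // EZ0.
      by have : (E j `&` Z) x by []; rewrite EZ0.
    move=> j; rewrite /cut; case: ifP => // _.
    by rewrite diam0 lee_fin ltW.
  apply: (le_trans (leeD (cut_size P _) (cut_size Q _))); [by left|by right|].
  rewrite -nneseriesD; [|by move=> *; exact: hausdorff_gauge_ge0..].
  apply: lee_nneseries => j _.
    by move=> _; apply: adde_ge0; exact: hausdorff_gauge_ge0.
  rewrite /cut; case: eqP => [_|/eqP/set0P[x [Ex Px]]].
    by rewrite hausdorff_gauge0 add0e; case: ifP => // _;
      rewrite hausdorff_gauge0 hausdorff_gauge_ge0.
  case: eqP => [_|/eqP/set0P[y [Ey Qy]]]; first by rewrite hausdorff_gauge0 adde0.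
  have := dE j; rewrite leNgt => /negP[].
  apply: (@lt_le_trans _ _ (d x y)%:E).
    by rewrite lte_fin (le_lt_trans de)//; exact: PQ.
  by rewrite /diam le_max; apply/orP; right; apply: ereal_sup_ubound; exists (x, y).
(* The two suprema run over independent scales; passing to their minimum, capped by [e], can only
   increase both sizes. *)
have szmin (e1 e2 : R) : (0 < e1)%R -> (0 < e2)%R ->
    hausdorff_size d k e1 P + hausdorff_size d k e2 Q <=
    hausdorff d k (P `|` Q).
  move=> e10 e20; set m := Num.min e (Num.min e1 e2).
  have m0 : (0 < m)%R by rewrite !lt_min e0 e10.
  apply: (@le_trans _ _ (hausdorff_size d k m P + hausdorff_size d k m Q)).
    by apply: leeD; apply: hausdorff_size_anti; rewrite !ge_min lexx ?orbT.
  apply: le_trans (hausdorff_size_le _ m0); apply: sz.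
  by rewrite m0 ge_min lexx.
have [->|/eqP PQoo] := eqVneq (hausdorff d k (P `|` Q)) +oo; first exact: leey.
have fin (Z : set T) : Z `<=` P `|` Q -> hausdorff d k Z \is a fin_num.
  move=> ZPQ; rewrite ge0_fin_numE ?hausdorff_ge0//.
  by rewrite (le_lt_trans (le_hausdorff ZPQ))// ltey; apply/eqP.
have fP : hausdorff d k P \is a fin_num by apply: fin; left.
have fQ : hausdorff d k Q \is a fin_num by apply: fin; right.
rewrite -leeBrDr//; apply: ge_ereal_sup => _ [e1 e10 <-].
rewrite leeBrDr// addeC -leeBrDr; last first.
  rewrite ge0_fin_numE ?hausdorff_size_ge0// (le_lt_trans (hausdorff_size_le _ e10))//.
  by rewrite -ge0_fin_numE ?hausdorff_ge0.
apply: ge_ereal_sup => _ [e2 e20 <-].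
rewrite leeBrDr; last first.
  rewrite ge0_fin_numE ?hausdorff_size_ge0// (le_lt_trans (hausdorff_size_le _ e10))//.
  by rewrite -ge0_fin_numE ?hausdorff_ge0.
by rewrite addeC; exact: szmin.
Qed.

(* Caratheodory's criterion. Writing [v j] for the measure of the part of [X]
   where [h > 1/(j+1)] and [a j] for that of the shell
   [1/(j+3) < h <= 1/(j+2)], separation gives [v j + a j <= v j.+2], so the
   [a j] are summable and their tails bridge [v j] and the part where [h > 0]. *)
Lemma caratheodory_hausdorff_gt0 (h : T -> R) (L : R) : (0 < L)%R ->
  (forall x y, h x - h y <= L * d x y)%R ->
  (hausdorff d k).-caratheodory [set x | (0 < h x)%R].
Proof.
move=> L0 hL; apply: le_caratheodory_measurable => X /=.
have [->|/eqP Xoo] := eqVneq (hausdorff d k X) +oo; first exact: leey.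
have fin (Z : set T) : Z `<=` X -> hausdorff d k Z \is a fin_num.
  move=> ZX; rewrite ge0_fin_numE ?hausdorff_ge0//.
  by rewrite (le_lt_trans (le_hausdorff ZX))// ltey; apply/eqP.
have sep (a b : R) (P Q Z : set T) : (a < b)%R ->
    (forall x, P x -> b < h x)%R -> (forall x, Q x -> h x <= a)%R ->
    P `|` Q `<=` Z ->
    hausdorff d k P + hausdorff d k Q <= hausdorff d k Z.
  move=> ab Pb Qa PQZ; apply: le_trans (le_hausdorff PQZ).
  apply: (@hausdorff_separated _ _ ((b - a) / L)%R).
    by rewrite divr_gt0// subr_gt0.
  move=> x y /Pb bx /Qa ay; rewrite ltr_pdivrMr// mulrC.
  by apply: lt_le_trans (hL _ _); lra.
pose t j : R := (j.+1%:R^-1)%R.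
have t_gt0 j : (0 < t j)%R by rewrite invr_gt0.
have t_lt j : (t j.+1 < t j)%R by rewrite ltf_pV2 ?posrE// ltr_nat.
pose v j := hausdorff d k (X `&` [set x | (t j < h x)%R]).
pose shell j := X `&` [set x | (t j.+2 < h x <= t j.+1)%R].
pose a j := hausdorff d k (shell j).
have v_fin j : v j \is a fin_num by apply: fin => x [].
have a_fin j : a j \is a fin_num by apply: fin => x [].
have va j : v j + a j <= v j.+2.
  apply: (sep (t j.+1) (t j)) => // [x [_ //]|x [_ /andP[]//]|].
  move=> x [[Xx /= tx]|[Xx /andP[tx _]]]; split => //=.
  by rewrite (lt_trans _ tx)// (lt_trans (t_lt _)).
(* Shells with indices of equal parity telescope separately, hence two terms on the right. *)
have a_sum N : \sum_(0 <= j < N) a j <= v N + v N.+1.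
  elim: N => [|N IH].
    by rewrite big_geq// adde_ge0//; exact: hausdorff_ge0.
  rewrite big_nat_recr//=; apply: le_trans (leeD2r _ IH) _.
  by rewrite [v N + _]addeC -addeA leeD2l.
have v_le j : v j <= hausdorff d k X by apply: le_hausdorff => x [].
have a_ser : \sum_(j <oo) a j < +oo.
  apply: (@le_lt_trans _ _ (hausdorff d k X + hausdorff d k X)).
    apply: lime_le; first by apply: is_cvg_nneseries => *; exact: hausdorff_ge0.
    by apply: nearW => N; rewrite (le_trans (a_sum N))// leeD.
  by rewrite lte_add_pinfty// ltey; exact/eqP.
have tail := @nneseries_tail_cvg _ a xpredT a_ser (fun j _ => hausdorff_ge0 _).
apply/lee_addgt0Pr => e e0.
have [N _ /(_ N (leqnn N)) tailN] :
    \forall N \near \oo, \sum_(N <= j <oo) a j < e%:E.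
  have [|M _ sM] := tail (fun u => u < e%:E).
    by apply: open_ereal_lt'; rewrite lte_fin.
  by exists M.
(* If [m] is the first index with [t m < h x], then [x] lies in shell [m.-2], since shell [j] sits
   between the levels [j.+2] and [j.+1]. *)
have UN : X `&` [set x | (0 < h x)%R] `<=`
    (X `&` [set x | (t N.+1 < h x)%R]) `|` \bigcup_(j in ~` `I_N) shell j.
  move=> x [Xx /= hx]; have [tN|hN] := ltP (t N.+1) (h x); first by left.
  have t_ex : exists m, (t m < h x)%R.
    by have [m] := ltr_add_invr hx; rewrite add0r; exists m.
  case: (ex_minnP t_ex) => m tm m_min; right.
  have Nm : (N.+1 < m)%N.
    rewrite ltnNge; apply/negP => mN; have : (t N.+1 < t N.+1)%R; last by rewrite ltxx.
    apply: lt_le_trans hN; apply: le_lt_trans tm.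
    by rewrite lef_pV2 ?posrE// ler_nat.
  exists m.-2; first by rewrite /=; lia.
  have mE : m = m.-2.+2 by lia.
  split => //=; rewrite -mE tm /= leNgt; apply/negP => /m_min; lia.
apply: (@le_trans _ _ (v N.+1 + e%:E + hausdorff d k (X `&` ~` [set x | 0 < h x]%R))).
  rewrite leeD2r// (le_trans (le_hausdorff UN))//.
  apply: le_trans (outer_measureU2 _ _ _) _; rewrite leeD2l//.
  exact: le_trans (outer_measure_sigma_subadditive_tail _ _ _) (ltW _).
rewrite addeAC leeD2r//.
apply: (sep 0%R (t N.+1)) => // [x [_ //]|x [_ /negP]|x].
  by rewrite -leNgt.
by move=> [[]|[]].
Qed.
End HausdorffOuterMeasure.

(** * Lebesgue measure of boxes *)

Section LebesgueBox.
Local Open Scope ereal_scope.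
Context (R : realType).

(* Integrating out one coordinate at a time reduces the volume comparison to
   countable additivity of the integral on the line. *)
Lemma prod_measure_cover (m : nat) (c : R) (ck : nat -> R)
    (E : nat -> set R) (Ek : nat -> nat -> set R) (v : nat -> R)
    (vk : nat -> nat -> R) :
  (0 <= c)%R -> (forall k, 0 <= ck k)%R ->
  (forall i, measurable (E i)) -> (forall k i, measurable (Ek k i)) ->
  (forall i, lebesgue_measure (E i) = (v i)%:E) ->
  (forall k i, lebesgue_measure (Ek k i) = (vk k i)%:E) ->
  (forall x : nat -> R, (c * \prod_(i < m) \1_(E i) (x i))%:E <=
     \sum_(k <oo) (ck k * \prod_(i < m) \1_(Ek k i) (x i))%:E) ->
  (c * \prod_(i < m) v i)%:E <= \sum_(k <oo) (ck k * \prod_(i < m) vk k i)%:E.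
Proof.
move=> + + mE mEk vE vkE.
have v0 i : (0 <= v i)%R by rewrite -lee_fin -vE.
have vk0 k i : (0 <= vk k i)%R by rewrite -lee_fin -vkE.
elim: m c ck => [|m IH] c ck c0 ck0 cover.
  have := cover (fun=> 0%R); rewrite !big_ord0.
  by congr (_ <= _); apply: eq_eseriesr => k _; rewrite !big_ord0.
rewrite big_ord_recr /= (mulrC (\prod_(i < m) _)%R) mulrA.
rewrite (_ : \sum_(k <oo) _ =
    \sum_(k <oo) (ck k * vk k m * \prod_(i < m) vk k i)%:E); last first.
  apply: eq_eseriesr => k _; rewrite big_ord_recr /=; congr _%:E.
  by rewrite -!mulrA (mulrC (vk k m)).
apply: IH => [|k|x]; [exact: mulr_ge0..|].
(* The first [m] coordinates are frozen at [x]; the last one is the integration variable. *)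
pose z y i := if (i < m)%N then x i else y.
have zx y (S : nat -> set R) :
    (\prod_(i < m.+1) \1_(S i) (z y i) =
     \prod_(i < m) \1_(S i) (x i) * \1_(S m) y :> R)%R.
  rewrite big_ord_recr /= /z ltnn; congr (_ * _)%R.
  by apply: eq_bigr => i _; rewrite ltn_ord.
have int1 (S : set R) (a u : R) : (0 <= a)%R -> measurable S ->
    lebesgue_measure S = u%:E ->
    \int[lebesgue_measure]_(y in setT) (a%:E * (\1_S y)%:E) = (a * u)%:E.
  move=> a0 mS Su; rewrite ge0_integralZl_EFin//; last first.
    exact/measurable_EFinP/measurable_indic.
  by rewrite integral_indic// setIT EFinM; congr (_ * _); exact: Su.
have pr0 (S : nat -> set R) : (0 <= \prod_(i < m) \1_(S i) (x i) :> R)%R.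
  exact: prodr_ge0.
have mterm (a : R) (S : set R) : measurable S ->
    measurable_fun [set: R] (fun y : R => a%:E * (\1_S y)%:E).
  move=> mS; apply/measurable_EFinP.
  by apply: measurable_funM => //; exact: measurable_indic.
have term0 (a : R) (S : set R) y : (0 <= a)%R -> 0 <= a%:E * (\1_S y)%:E.
  by move=> a0; rewrite mule_ge0// lee_fin.
have -> : (c * v m * \prod_(i < m) \1_(E i) (x i))%:E =
    \int[lebesgue_measure]_(y in setT)
      ((c * \prod_(i < m) \1_(E i) (x i))%:E * (\1_(E m) y)%:E).
  by rewrite (int1 _ _ (v m)) ?mulr_ge0//; congr _%:E; rewrite mulrAC.
have -> : \sum_(k <oo) (ck k * vk k m * \prod_(i < m) \1_(Ek k i) (x i))%:E =
    \int[lebesgue_measure]_(y in setT)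
      \sum_(k <oo) ((ck k * \prod_(i < m) \1_(Ek k i) (x i))%:E * (\1_(Ek k m) y)%:E).
  rewrite integral_nneseries//; last 2 first.
  - by move=> k; exact: mterm.
  - by move=> k y _; apply: term0; rewrite mulr_ge0.
  apply: eq_eseriesr => k _.
  by rewrite (int1 _ _ (vk k m)) ?mulr_ge0//; congr _%:E; rewrite mulrAC.
apply: ge0_le_integral => //.
- by move=> y _; apply: term0; rewrite mulr_ge0.
- exact: mterm.
- apply: ge0_emeasurable_sum => [k y _ _|k _]; last exact: mterm.
  by apply: term0; rewrite mulr_ge0.
move=> y _; have := cover (z y); rewrite zx mulrA EFinM.
move=> /le_trans; apply; rewrite le_eqVlt; apply/orP; left; apply/eqP.
by apply: eq_eseriesr => k _; rewrite zx mulrA EFinM.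
Qed.

Context (n : nat).

Lemma indic_box (ab : 'rV[R]_n.+1 * 'rV[R]_n.+1) (x : 'rV[R]_n.+1) :
  (\1_(box ab) x = \prod_(i < n.+1)
    \1_([set` `]ab.1 ord0 i, ab.2 ord0 i]]) (x ord0 i) :> R)%R.
Proof.
have [xab|xab] := pselect (box ab x).
  rewrite indicE mem_set// big1// => i _; rewrite indicE mem_set//=.
  by rewrite in_itv /=; exact: xab.
rewrite indicE memNset//; move/existsNP: xab => [i /negP xi].
rewrite (bigD1 i)//= indicE memNset ?mul0r//= in_itv /=; exact/negP.
Qed.

Lemma lebesgue_measure_oc (a b : R) :
  lebesgue_measure ([set` `]a, b]] : set R) = (Num.max 0 (b - a))%:E.
Proof.
rewrite lebesgue_measure_itv /= lte_fin; case: ltP => ab.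
  by rewrite (max_idPr _)// subr_ge0 ltW.
by rewrite (max_idPl _)// subr_le0.
Qed.

(** A cover bounds the indicator of the box by the sum of the indicators of its members. All of
    these are products over coordinates, so [prod_measure_cover] integrates the inequality. *)
Lemma box_volume_le_outer (ab : 'rV[R]_n.+1 * 'rV[R]_n.+1) :
  box_volume ab <= lebesgue_outer (box ab).
Proof.
apply: le_ereal_inf_tmp => _ [s abs <-].
pose side (u : 'rV[R]_n.+1 * 'rV[R]_n.+1) (i : nat) : set R :=
  [set` `]u.1 ord0 (inord i), u.2 ord0 (inord i)]].
pose vol (u : 'rV[R]_n.+1 * 'rV[R]_n.+1) (i : nat) : R :=
  Num.max 0%R (u.2 ord0 (inord i) - u.1 ord0 (inord i))%R.
have volE u : box_volume u = (1 * \prod_(i < n.+1) vol u i)%:E.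
  rewrite mul1r; congr _%:E; apply: eq_bigr => i _.
  by rewrite /vol inord_val.
rewrite volE (eq_eseriesr (fun k _ => volE (s k))).
apply: (@prod_measure_cover n.+1 1%R (fun=> 1%R) (side ab) (fun k => side (s k))
  (vol ab) (fun k => vol (s k))) => //.
- by move=> i; exact: measurable_itv.
- by move=> k i; exact: measurable_itv.
- by move=> i; exact: lebesgue_measure_oc.
- by move=> k i; exact: lebesgue_measure_oc.
move=> x; pose x' : 'rV[R]_n.+1 := \row_i x i.
have indE u :
    (1 * \prod_(i < n.+1) \1_(side u i) (x i))%:E = (\1_(box u) x')%:E :> \bar R.
  rewrite mul1r; congr _%:E; rewrite indic_box; apply: eq_bigr => i _.
  by rewrite /side inord_val mxE.
rewrite indE (eq_eseriesr (fun k _ => indE (s k))).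
have [/[dup]abx /abs [k _ skx]|abx] := pselect (box ab x'); last first.
  rewrite indicE memNset//; apply: nneseries_ge0 => k _ _.
  by rewrite lee_fin.
apply: le_trans (nneseries_lim_ge k.+1 _); last by move=> *; rewrite lee_fin.
rewrite big_nat_recr//= [leLHS](_ : _ = 1); last by rewrite indicE mem_set.
rewrite [X in _ + X](_ : _ = 1); last by rewrite indicE mem_set.
by rewrite leeDr// sume_ge0// => j _; rewrite lee_fin.
Qed.

Definition halfspace (i : 'I_n.+1) (c : R) : set 'rV[R]_n.+1 :=
  [set x | (x ord0 i <= c)%R].

(** A coordinate hyperplane cuts a half-open box into two half-open boxes whose volumes add up
    exactly, so covers split without loss. The clamp at [0] in [box_volume] absorbs boxes lying on
    one side. *)
Lemma caratheodory_halfspace (i : 'I_n.+1) (c : R) :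
  (@lebesgue_outer R n).-caratheodory (halfspace i c).
Proof.
apply: le_caratheodory_measurable => X /=.
apply: le_ereal_inf_tmp => _ [s Xs <-].
pose upd (u : 'rV[R]_n.+1) t : 'rV[R]_n.+1 :=
  \row_j if j == i then t else u ord0 j.
pose lo (ab : 'rV[R]_n.+1 * 'rV[R]_n.+1) :=
  (ab.1, upd ab.2 (Num.min (ab.2 ord0 i) c)).
pose hi (ab : 'rV[R]_n.+1 * 'rV[R]_n.+1) :=
  (upd ab.1 (Num.max (ab.1 ord0 i) c), ab.2).
have bv0 (u : 'rV[R]_n.+1 * 'rV[R]_n.+1) : 0 <= box_volume u.
  by rewrite lee_fin; apply: prodr_ge0 => j _; rewrite le_max lexx.
have split_vol ab : box_volume ab = box_volume (lo ab) + box_volume (hi ab).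
  rewrite -EFinD /box_volume; congr _%:E.
  rewrite (bigD1 i)//= [X in _ = (X + _)%R](bigD1 i)//=.
  rewrite [X in _ = (_ + X)%R](bigD1 i)//= !mxE eqxx.
  pose p : R := (\prod_(j < n.+1 | j != i) Num.max 0 (ab.2 ord0 j - ab.1 ord0 j))%R.
  rewrite [X in _ = (_ * X + _)%R](_ : _ = p); last first.
    by apply: eq_bigr => j /negbTE ji; rewrite mxE ji.
  rewrite [X in _ = (_ + _ * X)%R](_ : _ = p); last first.
    by apply: eq_bigr => j /negbTE ji; rewrite mxE ji.
  rewrite -mulrDl; congr (_ * _)%R.
  rewrite /Num.max /Num.min; case: (ltP (ab.2 ord0 i) c) => ?;
    case: (ltP (ab.1 ord0 i) c) => ?; repeat case: ltP => ?; lra.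
rewrite (eq_eseriesr (fun k _ => split_vol (s k))) nneseriesD//.
apply: leeD; apply: ereal_inf_lbound.
  exists (lo \o s) => // x [/Xs[k _ skx] /= xc]; exists k => // j.
  have := skx j; rewrite /= mxE; case: eqP => [->|//].
  by rewrite le_min => /andP[-> ->].
exists (hi \o s) => // x [/Xs[k _ skx] /negP]; rewrite /= -ltNge => xc; exists k => // j.
have := skx j; rewrite /= mxE; case: eqP => [->|//].
by rewrite gt_max => /andP[-> ->]; rewrite xc.
Qed.

Lemma caratheodory_box (ab : 'rV[R]_n.+1 * 'rV[R]_n.+1) :
  (@lebesgue_outer R n).-caratheodory (box ab).
Proof.
have -> : box ab = \bigcap_(k : nat)
    (halfspace (inord k) (ab.2 ord0 (inord k)) `\`
     halfspace (inord k) (ab.1 ord0 (inord k))).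
  apply/seteqP; split=> x.
    by move=> xab k _; have /andP[] := xab (inord k); rewrite ltNge => /negP.
  move=> xab i; have [] := xab i I; rewrite inord_val => ib /negP.
  by rewrite /= -ltNge => ->.
apply: (@bigcapT_measurable _ (caratheodory_type (@lebesgue_outer R n))) => k.
by apply: caratheodory_measurable_setD; exact: caratheodory_halfspace.
Qed.

(* No measurability of [f] is needed: the integral of a nonnegative function is
   a supremum over the simple functions below it. *)
Lemma box_volume_le_integral (ab : 'rV[R]_n.+1 * 'rV[R]_n.+1)
    (D : set 'rV[R]_n.+1) (f : 'rV[R]_n.+1 -> R) :
  (forall x, 0 <= f x)%R -> box ab `<=` D -> (forall x, box ab x -> 1 <= f x)%R ->
  box_volume ab <= \int[lebesgue R n]_(x in D) (f x)%:E.
Proof.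
move=> f0 abD abf; apply: le_trans (box_volume_le_outer ab) _.
rewrite ge0_integralE; last by move=> x _; rewrite lee_fin.
have mab : measurable (box ab : set (caratheodory_type (@lebesgue_outer R n))).
  exact: caratheodory_box.
apply: ereal_sup_ubound; exists (indic_nnsfun R mab) => /=; last first.
  exact: sintegral_indic.
move=> x; rewrite [X in X%:E <= _](_ : _ = (x \in box ab)%:R)//.
rewrite /patch; case: ifPn => [_|xD]; rewrite lee_fin.
  have [xab|xab] := boolP (x \in box ab); rewrite ?f0//.
  by apply: abf; rewrite inE in xab.
rewrite (_ : (x \in box ab) = false)//; apply: contraNF xD.
by rewrite !inE => /abD.
Qed.

End LebesgueBox.

(** * The conjugate norm *)

Lemma dist_le_continuous_at (R : realType) (V : normedModType R)
    (f : V -> R) (K : R) (u : V) :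
  0 <= K -> (forall v, `|f u - f v| <= K * `|u - v|) -> {for u, continuous f}.
Proof.
move=> K0 fK; apply/cvgrPdist_lt => e e0; apply/nbhs_ballP.
have K1 : 0 < K + 1 by rewrite ltr_wpDl.
exists (e / (K + 1)) => /=; first by rewrite divr_gt0.
move=> v; rewrite -ball_normE /= ltr_pdivlMr// => uve.
apply: le_lt_trans uve; apply: le_trans (fK v) _.
by have n0 := normr_ge0 (u - v); lra.
Qed.

Lemma one_sided_lipschitz_continuous (R : realType) (V : normedModType R)
    (f : V -> R) (K : R) :
  0 <= K -> (forall u v, f u - f v <= K * `|u - v|) -> continuous f.
Proof.
move=> K0 fK u; apply: (dist_le_continuous_at K0) => v; rewrite ler_norml.
have := fK u v; have := fK v u; rewrite distrC => ? ?.
by apply/andP; split; lra.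
Qed.

(** * Sup norm, dot product and Euclidean norm *)

Section SupNorm.
Context (R : realType) (m : nat).
Implicit Types u v w : 'rV[R]_m.

Lemma coord_le_norm u (i : 'I_m) : `|u ord0 i| <= `|u|.
Proof.
rewrite [leRHS]/Num.norm /= mx_normrE.
exact: (le_bigmax _ (fun ij : 'I_1 * 'I_m => `|u ij.1 ij.2|) (ord0, i)).
Qed.

Lemma norm_le_coords u (e : R) : 0 <= e ->
  (forall i, `|u ord0 i| <= e) -> `|u| <= e.
Proof.
move=> e0 ue; rewrite [leLHS]/Num.norm /= mx_normrE; apply: bigmax_le => //= -[i j] _ /=.
by rewrite (ord1 i).
Qed.

Lemma dotvC u v : dotv u v = dotv v u.
Proof. by apply: eq_bigr => i _; rewrite mulrC. Qed.

Lemma dotvDl u v w : dotv (u + v) w = dotv u w + dotv v w.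
Proof. by rewrite -big_split; apply: eq_bigr => i _; rewrite mxE mulrDl. Qed.

Lemma dotvZl (a : R) u v : dotv (a *: u) v = a * dotv u v.
Proof. by rewrite mulr_sumr; apply: eq_bigr => i _; rewrite mxE mulrA. Qed.

Lemma dotvDr u v w : dotv u (v + w) = dotv u v + dotv u w.
Proof. by rewrite !(dotvC u) dotvDl. Qed.

Lemma dotvZr (a : R) u v : dotv u (a *: v) = a * dotv u v.
Proof. by rewrite !(dotvC u) dotvZl. Qed.

Lemma dotv0 u : dotv u 0 = 0.
Proof. by apply: big1 => i _; rewrite mxE mulr0. Qed.

Lemma dotv_le u v : dotv u v <= m%:R * `|u| * `|v|.
Proof.
have -> : m%:R * `|u| * `|v| = \sum_(i < m) `|u| * `|v|.
  by rewrite sumr_const card_ord -mulrA mulr_natl.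
apply: ler_sum => i _; apply: le_trans (ler_norm _) _; rewrite normrM.
by apply: ler_pM => //; exact: coord_le_norm.
Qed.

Lemma dotvv_ge0 u : 0 <= dotv u u.
Proof. by apply: sumr_ge0 => i _; rewrite -expr2 sqr_ge0. Qed.

Lemma norm_sqr_le_dotvv u : `|u| ^+ 2 <= dotv u u.
Proof.
rewrite -[leRHS]sqr_sqrtr ?dotvv_ge0// lerXn2r ?nnegrE ?sqrtr_ge0//.
apply: norm_le_coords => [|i]; first exact: sqrtr_ge0.
rewrite -sqrtr_sqr ler_wsqrtr// /dotv (bigD1 i)//= -expr2 lerDl.
by apply: sumr_ge0 => j _; rewrite -expr2 sqr_ge0.
Qed.

Lemma norm_le_enorm u : `|u| <= enorm u.
Proof.
rewrite -(@ler_pXn2r _ 2) ?nnegrE ?sqrtr_ge0// sqr_sqrtr ?dotvv_ge0//.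
exact: norm_sqr_le_dotvv.
Qed.

Lemma dotvv_eq0 u : dotv u u = 0 -> u = 0.
Proof.
move=> uu0; have := norm_sqr_le_dotvv u; rewrite uu0.
by rewrite exprn_even_le0//= normr_eq0 => /eqP.
Qed.

Lemma norm_fst_le_edist2 (p q : 'rV[R]_m * 'rV[R]_m) : `|p.1 - q.1| <= edist2 p q.
Proof.
apply: le_trans (norm_le_enorm _) _.
have e0 : 0 <= enorm (p.1 - q.1) by exact: sqrtr_ge0.
rewrite -(ger0_norm e0) -sqrtr_sqr ler_wsqrtr//.
by rewrite lerDl sqr_ge0.
Qed.

Lemma norm_snd_le_edist2 (p q : 'rV[R]_m * 'rV[R]_m) : `|p.2 - q.2| <= edist2 p q.
Proof.
apply: le_trans (norm_le_enorm _) _.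
have e0 : 0 <= enorm (p.2 - q.2) by exact: sqrtr_ge0.
rewrite -(ger0_norm e0) -sqrtr_sqr ler_wsqrtr//.
by rewrite lerDr sqr_ge0.
Qed.

End SupNorm.

Section Conjugate.
Context (R : realType) (n : nat) (F : 'rV[R]_n.+1 -> R).
Context (F_C11 : integrand_C11 F) (F_elliptic : elliptic F).
Local Notation V := 'rV[R]_n.+1.
Local Notation phi := (conjugate F).

Let F_ge0 u : 0 <= F u. Proof. by case: F_C11. Qed.
Let FZ (l : R) u : F (l *: u) = `|l| * F u. Proof. by case: F_C11. Qed.
Let F0 : F 0 = 0. Proof. by rewrite -(scale0r 0) FZ normr0 mul0r. Qed.

(** Convexity of [F - gamma * enorm] is applied at the midpoint [0] of [u] and [- u], where evenness
    of [F] makes the two end values equal. *)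
Lemma integrand_lower_bound : exists2 g : R, 0 < g & forall u, g * `|u| <= F u.
Proof.
case: F_elliptic => g g0 cvx; exists g => // u.
have half0 : 0 <= 2^-1 :> R by lra.
have half1 : 2^-1 <= 1 :> R by lra.
have := cvx (Itv01 half0 half1) u (- u); rewrite !in_setT => /(_ isT isT).
rewrite convRE /= /conv /= /unstable.onem.
have h : 1 - 2^-1 = 2^-1 :> R by lra.
rewrite h scalerN subrr F0.
have en0 : enorm (0 : V) = 0 by rewrite /enorm dotv0 sqrtr0.
have enN : enorm (- u) = enorm u.
  by rewrite /enorm -scaleN1r dotvZl dotvZr mulrA mulrNN !mul1r.
have FN : F (- u) = F u by rewrite -scaleN1r FZ normrN1 mul1r.
rewrite en0 enN FN mulr0 subr0 -mulrDl -[_ + _]/(2^-1 + 2^-1) => le0.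
have : g * enorm u <= F u by lra.
by apply: le_trans; rewrite ler_pM2l// norm_le_enorm.
Qed.

Lemma integrand_diff w : w != 0 -> differentiable (F : V -> R^o) w.
Proof. by case: F_C11 => _ _ FC /eqP w0; have [] := FC w w0. Qed.

(** Differentiability gives continuity away from [0], hence a bound on the compact unit sphere,
    which homogeneity spreads to all [u]. *)
Lemma integrand_upper_bound : exists2 C : R, 0 < C & forall u, F u <= C * `|u|.
Proof.
pose S : set V := [set u | `|u| = 1].
have S_compact : compact S.
  apply: bounded_closed_compact.
    by exists 1; split => // x x1 u /= ->; exact: ltW.
  have -> : S = Num.norm @^-1` [set 1] by [].
  by apply: closed_comp => [u _|]; [exact: norm_continuous|exact: closed_eq].
have : compact (F @` S).
  apply: continuous_compact => //; apply: continuous_in_subspaceT => u.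
  rewrite inE => u1; apply: differentiable_continuous; apply: integrand_diff.
  by rewrite -normr_eq0 u1 oner_eq0.
move=> /compact_bounded[M [_ FM]]; exists (`|M| + 1); first by rewrite ltr_wpDl.
move=> u; have [->|u0] := eqVneq u 0; first by rewrite F0 normr0 mulr0.
have nu0 : 0 < `|u| by rewrite normr_gt0.
have MM : M < `|M| + 1 by rewrite (le_lt_trans (ler_norm M))// ltrDl.
have Su : (F @` S) (F (`|u|^-1 *: u)).
  by exists (`|u|^-1 *: u) => //; rewrite /S /= normrZ ger0_norm// mulVf ?gt_eqF.
have /= := FM _ MM _ Su.
by rewrite ger0_norm// FZ ger0_norm// mulrC ler_pdivrMr.
Qed.

Lemma integrand_continuous : continuous F.
Proof.
move=> w; have [->|w0] := eqVneq w 0; last first.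
  exact: differentiable_continuous (integrand_diff w0).
have [C C0 FC] := integrand_upper_bound.
apply: (dist_le_continuous_at (ltW C0)) => u.
by rewrite F0 !sub0r !normrN ger0_norm.
Qed.

(** Without boundedness [sup] would be a default value; the lower bound on [F] provides it. *)
Lemma conjugate_has_sup (w : V) : has_sup [set dotv w u | u in [set u | F u <= 1]].
Proof.
have [g g0 Fg] := integrand_lower_bound.
split; first by exists 0, 0; rewrite /= ?F0 ?ler01// dotv0.
exists (n.+1%:R * `|w| * g^-1) => _ [u /= Fu <-].
apply: le_trans (dotv_le _ _) _; rewrite ler_wpM2l// ?mulr_ge0//.
by rewrite -[leRHS]div1r ler_pdivlMr// mulrC (le_trans (Fg u)).
Qed.

Lemma dotv_le_conjugate w u : dotv w u <= phi w * F u.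
Proof.
have [g g0 Fg] := integrand_lower_bound.
have [u0|u0] := eqVneq u 0; first by rewrite u0 dotv0 F0 mulr0.
have Fu0 : 0 < F u by apply: lt_le_trans (Fg u); rewrite mulr_gt0// normr_gt0.
rewrite -ler_pdivrMr//; apply: ub_le_sup; first by case: (conjugate_has_sup w).
exists ((F u)^-1 *: u); last by rewrite dotvZr mulrC.
by rewrite /= FZ ger0_norm ?invr_ge0// mulVf ?gt_eqF.
Qed.

(** The sublevel set of [F] is compact, so later arguments can pick a maximizer instead of handling
    suprema. *)
Lemma conjugate_attained w : exists2 u, F u <= 1 & dotv w u = phi w.
Proof.
have [g g0 Fg] := integrand_lower_bound.
pose S : set V := [set u | F u <= 1].
have S_compact : compact S.
  apply: bounded_closed_compact.
    exists g^-1; split => [|x x1 u /= Fu]; first exact: num_real.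
    apply: ltW; apply: le_lt_trans x1.
    by rewrite -[leRHS]div1r ler_pdivlMr// mulrC (le_trans (Fg u)).
  have -> : S = F @^-1` [set x | x <= 1] by [].
  by apply: closed_comp => [u _|]; [exact: integrand_continuous|exact: closed_le].
have [||u] := @EVT_max_rV _ _ (dotv w) S _ S_compact.
- by exists 0; rewrite /S /= F0.
- apply: continuous_subspaceT => u.
  apply: (@one_sided_lipschitz_continuous _ _ _ (n.+1%:R * `|w|)) => [|a b].
    exact: mulr_ge0.
  apply: le_trans (dotv_le _ _); rewrite dotvDr.
  by rewrite -[- b]scaleN1r dotvZr mulN1r.
rewrite inE => Su umax; exists u => //; apply/eqP; rewrite eq_le; apply/andP; split.
  by apply: ub_le_sup; [case: (conjugate_has_sup w)|exists u].
apply: ge_sup; first by case: (conjugate_has_sup w).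
by move=> _ [v Sv <-]; apply: umax; rewrite inE.
Qed.

Lemma conjugate_ge0 w : 0 <= phi w.
Proof.
apply: ub_le_sup; first by case: (conjugate_has_sup w).
by exists 0; rewrite /= ?F0 ?ler01// dotv0.
Qed.

Lemma conjugateD u v : phi (u + v) <= phi u + phi v.
Proof.
have [w Fw <-] := conjugate_attained (u + v); rewrite dotvDl.
apply: lerD; apply: le_trans (dotv_le_conjugate _ _) _;
  by rewrite ler_piMr// conjugate_ge0.
Qed.

Lemma conjugateZ_le (a : R) w : phi (a *: w) <= `|a| * phi w.
Proof.
have [u Fu <-] := conjugate_attained (a *: w); rewrite dotvZl -dotvZr.
apply: le_trans (dotv_le_conjugate _ _) _.
by rewrite mulrC FZ ler_wpM2r ?conjugate_ge0// ler_piMr.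
Qed.

Lemma conjugateN w : phi (- w) = phi w.
Proof.
have le v : phi (- v) <= phi v.
  by rewrite -scaleN1r (le_trans (conjugateZ_le _ _))// normrN1 mul1r.
by apply/eqP; rewrite eq_le le/= -[X in phi X <= _]opprK le.
Qed.

Lemma conjugateBC u v : phi (u - v) = phi (v - u).
Proof. by rewrite -conjugateN opprB. Qed.

Lemma conjugateZ (a : R) w : phi (a *: w) = `|a| * phi w.
Proof.
have [->|a0] := eqVneq a 0.
  rewrite normr0 mul0r; apply/eqP; rewrite eq_le conjugate_ge0 andbT.
  by rewrite (le_trans (conjugateZ_le _ _))// normr0 mul0r.
apply/eqP; rewrite eq_le conjugateZ_le /= mulrC -ler_pdivlMr ?normr_gt0//.
rewrite mulrC -normfV -{1}[w](scalerK a0); exact: conjugateZ_le.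
Qed.

Lemma conjugate0 : phi 0 = 0.
Proof. by rewrite -(scale0r 0) conjugateZ normr0 mul0r. Qed.

Lemma conjugate_upper_bound : exists2 K : R, 0 < K & forall w, phi w <= K * `|w|.
Proof.
have [g g0 Fg] := integrand_lower_bound.
exists (n.+1%:R / g) => [|w]; first by rewrite divr_gt0.
have [u Fu <-] := conjugate_attained w.
apply: le_trans (dotv_le _ _) _; rewrite [leRHS]mulrAC ler_wpM2l ?mulr_ge0//.
rewrite -[leRHS]div1r ler_pdivlMr// mulrC.
exact: le_trans (Fg u) Fu.
Qed.

(** Testing the supremum against [w] itself gives [|w|^2 <= dotv w w <= phi w * F w <= phi w * C *
    |w|]. *)
Lemma conjugate_lower_bound : exists2 k : R, 0 < k & forall w, `|w| <= k * phi w.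
Proof.
have [C C0 FC] := integrand_upper_bound.
exists C => // w; have [->|w0] := eqVneq w 0.
  by rewrite normr0 conjugate0 mulr0.
have nw : 0 < `|w| by rewrite normr_gt0.
rewrite -(ler_pM2r nw) -expr2 (le_trans (norm_sqr_le_dotvv w))//.
apply: le_trans (dotv_le_conjugate _ _) _.
by rewrite (mulrC C) -mulrA ler_wpM2l ?conjugate_ge0.
Qed.

Lemma conjugate_gt0 w : w != 0 -> 0 < phi w.
Proof.
move=> w0; have [k k0 kphi] := conjugate_lower_bound.
by rewrite -(pmulr_rgt0 _ k0) (lt_le_trans _ (kphi w))// normr_gt0.
Qed.

(* Equality in [dotv u w <= phi u * F w] makes [w] a minimum of the
   difference, so differentiability of [F] determines [u] up to scaling. *)
Lemma conjugate_gradient u w h : w != 0 -> dotv u w = phi u * F w ->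
  phi u * 'd (F : V -> R^o) w h = dotv u h.
Proof.
move=> w0 uw.
have half k : dotv u k <= phi u * 'd (F : V -> R^o) w k.
  have dF := integrand_diff w0.
  have /cvg_dnbhs_at_right lim_k := @diff_derivable _ _ _ _ _ k dF.
  rewrite -deriveE//.
  have {}lim_k : phi u * (t^-1 * (F (t *: k + w) - F w)) @[t --> 0^'+] -->
      phi u * 'D_k (F : V -> R^o) w.
    by apply: cvgMr; exact: lim_k.
  apply: (cvgr_to_ge lim_k); near=> t.
  have t0 : 0 < t by [].
  rewrite mulrCA mulrC ler_pdivlMr//.
  have := dotv_le_conjugate u (t *: k + w).
  by rewrite dotvDr dotvZr uw mulrBr; lra.
apply/eqP; rewrite eq_le half andbT -lerN2.
have := half (- h); rewrite linearN -[X in dotv u X]scaleN1r dotvZr.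
by rewrite mulN1r mulrN.
Unshelve. all: by end_near. Qed.

(** A maximizer [w] for [u + v] must be extremal for [u] and for [v] separately. Then [u / phi u]
    and [v / phi v] both represent the derivative of [F] at [w]. *)
Lemma conjugate_strict u v : u != 0 -> v != 0 -> phi (u + v) = phi u + phi v ->
  phi v *: u = phi u *: v.
Proof.
move=> u0 v0 uvE; have [w Fw] := conjugate_attained (u + v).
rewrite uvE dotvDl => uvw.
have := conjugate_gt0 u0; have := conjugate_gt0 v0 => pv pu.
have le1 x : phi x * F w <= phi x by rewrite ler_piMr// conjugate_ge0.
have := dotv_le_conjugate u w; have := dotv_le_conjugate v w.
have := le1 u; have := le1 v => l1 l2 l3 l4.
have uw : dotv u w = phi u * F w by lra.
have vw : dotv v w = phi v * F w by lra.
have w0 : w != 0.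
  by apply/eqP => w0; move: uvw; rewrite w0 !dotv0; lra.
(* For the difference [z] of the two sides, [dotv z z] becomes a difference of two equal multiples
   of the derivative of [F] at [w] along [z]. *)
apply/eqP; rewrite -subr_eq0; apply/eqP/dotvv_eq0.
set z := _ - _; rewrite {1}/z dotvDl -scaleNr !dotvZl.
rewrite -(conjugate_gradient z w0 uw) -(conjugate_gradient z w0 vw).
by rewrite mulrA mulNr mulrA (mulrC (phi v)) subrr.
Qed.

Lemma conjugate_lipschitz :
  exists2 K : R, 0 < K & forall u v, phi u - phi v <= K * `|u - v|.
Proof.
have [K K0 phiK] := conjugate_upper_bound; exists K => // u v.
by rewrite (le_trans _ (phiK _))// lerBlDr -{1}(subrK v u) conjugateD.
Qed.

End Conjugate.

(** * The anisotropic distance *)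

(** After subtracting [v] the polynomial has more roots than its size allows, so it is zero; at [0]
    it takes the value [- v], as every monomial has positive degree. *)
Lemma sum_monomials_constant (R : realType) (m : nat) (c : 'I_m -> R) (s r v : R) :
  s < r -> (forall t, s <= t < r -> \sum_(j < m) c j * t ^+ j.+1 = v) -> v = 0.
Proof.
move=> sr cv; pose p : {poly R} := \sum_(j < m) c j *: 'X^(j.+1) - v%:P.
have pE t : p.[t] = \sum_(j < m) c j * t ^+ j.+1 - v.
  rewrite hornerD hornerN hornerC horner_sum; congr (_ - _).
  by apply: eq_bigr => j _; rewrite hornerZ hornerXn.
have p0 : p.[0] = - v.
  by rewrite pE big1 ?sub0r// => j _; rewrite expr0n mulr0.
suff p_eq0 : p = 0 by apply/eqP; rewrite -oppr_eq0 -p0 p_eq0 horner0.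
apply/eqP/negPn/negP => pn0.
(* The denominator [k.+2] keeps all sample points strictly below [r]. *)
pose t k := s + (r - s) / k.+2%:R.
have := max_poly_roots pn0 (rs := mkseq t (size p)).
rewrite size_mkseq ltnn => h; suff: false by []; apply: h.
  apply/allP => _ /mapP[k _ ->]; rewrite /root pE cv ?subrr//.
  rewrite /t lerDl divr_ge0 ?subr_ge0 ?ltW//= -ltrBrDl ltr_pdivrMr//.
  by rewrite ltr_pMr ?subr_gt0// ltr1n.
apply/mkseq_uniqP => i j _ _ /addrI /mulfI.
by rewrite subr_eq0 gt_eqF// => /(_ isT)/invr_inj/eqP; rewrite eqr_nat => /eqP[].
Qed.

Lemma nbhs_box (R : realType) (n : nat) (x : 'rV[R]_n.+1) (U : set 'rV[R]_n.+1) :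
  nbhs x U -> exists2 ab, box ab `<=` U & (0 < box_volume ab)%E.
Proof.
move=> /nbhs_ballP[e /= e0 xU].
exists (x - const_mx (e / 2), x + const_mx (e / 2)).
  move=> y xy; apply: xU; rewrite -ball_normE /=.
  apply: (@le_lt_trans _ _ (e / 2)); last lra.
  apply: norm_le_coords => [|i]; first lra.
  have := xy i; rewrite !mxE ler_norml => /andP[? ?].
  by apply/andP; split; lra.
rewrite lte_fin; apply: prodr_gt0 => i _; rewrite !mxE lt_max; apply/orP; right.
lra.
Qed.

Section AnisotropicDistance.
Context (R : realType) (n : nat) (F : 'rV[R]_n.+1 -> R).
Context (F_C11 : integrand_C11 F) (F_elliptic : elliptic F).
Context (A : set 'rV[R]_n.+1) (A_closed : closed A) (A_neq0 : A !=set0).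
Local Notation V := 'rV[R]_n.+1.
Local Notation phi := (conjugate F).
Local Notation d x := (fine (adist F A x)).

Lemma conjugate_continuous : continuous phi.
Proof.
have [K K0 phiK] := conjugate_lipschitz F_C11 F_elliptic.
exact: one_sided_lipschitz_continuous (ltW K0) phiK.
Qed.

Lemma conjugate_ball_closed (K : R) : closed [set w : V | phi w <= K].
Proof.
have -> : [set w : V | phi w <= K] = phi @^-1` [set x | x <= K] by [].
by apply: closed_comp => [u _|]; [exact: conjugate_continuous|exact: closed_le].
Qed.

Lemma conjugate_ball_compact (K : R) : compact [set w : V | phi w <= K].
Proof.
have [k k0 kphi] := conjugate_lower_bound F_C11 F_elliptic.
apply: bounded_closed_compact; last exact: conjugate_ball_closed.
exists (k * K); split => [|x x1 u /= uK]; first exact: num_real.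
by apply: ltW; apply: le_lt_trans x1; rewrite (le_trans (kphi u))// ler_pM2l.
Qed.

(** Continuity of [phi] gives one inclusion; for the other, radial shrinking [(1 - q) *: w]
    approaches a unit vector from inside the ball. *)
Lemma frontier_wulff : frontier (wulff F 0 1) = [set w | phi w = 1].
Proof.
have wE : wulff F 0 1 = phi @^-1` [set t | t < 1].
  by apply/seteqP; split => w; rewrite /wulff /= subr0.
have w_open : open (wulff F 0 1).
  by rewrite wE; apply: open_comp => [u _|]; [exact: conjugate_continuous|exact: open_lt].
rewrite /frontier (interior_id _).1//; apply/seteqP; split => w /=.
  move=> [cw]; rewrite wE /= => /negP; rewrite -leNgt => w1.
  apply/eqP; rewrite eq_le w1 andbT.
  have c1 : closed [set w : V | phi w <= 1].
    exact: conjugate_ball_closed.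
  have /closure_subset : wulff F 0 1 `<=` [set w : V | phi w <= 1].
    by rewrite wE => u /= /ltW.
  by rewrite -((closure_id _).1 c1); apply.
move=> w1; split; last by rewrite wE /= w1 ltxx.
move=> U /nbhs_ballP[e /= e0 wU].
have w0 : 0 < `|w|.
  rewrite normr_gt0; apply/eqP => w0; move: w1.
  by rewrite w0 conjugate0// => /eqP; rewrite eq_sym oner_eq0.
(* The bound [1] makes the shrunk norm exactly [1 - q]; the other bound keeps the displacement at
   most [e / 2]. *)
pose q := Num.min 1 (e / (2 * `|w|)).
have q0 : 0 < q by rewrite lt_min ltr01 divr_gt0// mulr_gt0.
have q1 : q <= 1 by rewrite ge_min lexx.
exists ((1 - q) *: w); split.
  rewrite wE /= conjugateZ// w1 mulr1 ger0_norm ?subr_ge0//; lra.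
apply: wU; rewrite -ball_normE /= scalerBl scale1r opprB addrC subrK normrZ.
rewrite gtr0_norm//; apply: (@le_lt_trans _ _ (e / (2 * `|w|) * `|w|)).
  by rewrite ler_wpM2r// ge_min lexx orbT.
rewrite invfM mulrA mulfVK ?gt_eqF//; lra.
Qed.

Lemma nearest_exists x : nearest F A x !=set0.
Proof.
have [a0 Aa0] := A_neq0.
have phi_sub : continuous (fun a : V => phi (a - x)).
  have [K K0 phiK] := conjugate_lipschitz F_C11 F_elliptic.
  apply: (one_sided_lipschitz_continuous (ltW K0)) => u v.
  by rewrite (le_trans (phiK _ _))// opprB addrA subrK.
(* Only points no farther than a fixed [a0] compete, and these form a compact set. *)
pose K : set V := A `&` [set a : V | phi (a - x) <= phi (a0 - x)].
have K_compact : compact K.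
  have [k k0 kphi] := conjugate_lower_bound F_C11 F_elliptic.
  apply: bounded_closed_compact.
    exists (k * phi (a0 - x) + `|x|); split => [|y y1 u /= [_ uK]].
      exact: num_real.
    apply: ltW; apply: le_lt_trans y1; rewrite -{1}(subrK x u).
    rewrite (le_trans (ler_normD _ _))// lerD2r (le_trans (kphi _))//.
    by rewrite ler_pM2l.
  apply: closedI => //.
  apply: (@closed_comp _ _ (fun a : V => phi (a - x)) [set t | t <= _]) => [u _|].
    exact: phi_sub.
  exact: closed_le.
have [||a] := @EVT_min_rV _ _ (fun a : V => phi (a - x)) K _ K_compact.
- by exists a0; split => /=.
- exact: continuous_subspaceT.
rewrite inE => -[Aa /= aK] amin; exists a; split => //.
rewrite conjugateBC//; apply/eqP; rewrite eq_le; apply/andP; split.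
  apply: le_ereal_inf_tmp => _ [b Ab <-]; rewrite lee_fin.
  have [bK|/ltW bK] := leP (phi (b - x)) (phi (a0 - x)).
    by apply: amin; rewrite inE.
  exact: le_trans aK bK.
by apply: ereal_inf_lbound; exists a.
Qed.

Lemma adistE x : adist F A x = (d x)%:E.
Proof. by have [a [_ <-]] := nearest_exists x. Qed.

Lemma nearestE x a : nearest F A x a <-> A a /\ phi (x - a) = d x.
Proof. by rewrite /nearest /= adistE; split => -[Aa]; [case|move=> ->]. Qed.

Lemma dist_le x a : A a -> d x <= phi (x - a).
Proof.
move=> Aa; rewrite -lee_fin -adistE conjugateBC//.
by apply: ereal_inf_lbound; exists a.
Qed.

Lemma dist_triangle x y : d x <= d y + phi (x - y).
Proof.
have [a /nearestE[Aa <-]] := nearest_exists y.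
apply: le_trans (dist_le x Aa) _; rewrite [leRHS]addrC.
have -> : x - a = (x - y) + (y - a) by rewrite addrA subrK.
exact: conjugateD.
Qed.

Lemma dist_lipschitz : exists2 K : R, 0 < K & forall x y, d x - d y <= K * `|x - y|.
Proof.
have [K K0 phiK] := conjugate_upper_bound F_C11 F_elliptic; exists K => // x y.
by apply: le_trans (phiK _); have := dist_triangle x y; lra.
Qed.

Lemma dist_continuous : continuous (fun x : V => d x).
Proof.
have [K K0 dK] := dist_lipschitz.
exact: one_sided_lipschitz_continuous (ltW K0) dK.
Qed.

Lemma dist_ge0 x : 0 <= d x.
Proof.
by have [a /nearestE[_ <-]] := nearest_exists x; exact: conjugate_ge0.
Qed.

(** The point at length [s] lies between [a] and [x], at distance [d x - s] from [x], so the
    distance to [A] drops by at most that amount. *)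
Lemma dist_ray x a s : nearest F A x a -> 0 < s <= d x ->
  s <= d (a + s *: ((d x)^-1 *: (x - a))).
Proof.
move=> /nearestE[Aa xa] /andP[s0 sx].
have dx0 : 0 < d x by rewrite (lt_le_trans s0).
have := dist_triangle x (a + s *: ((d x)^-1 *: (x - a))).
rewrite opprD addrA scalerA -{2}(scale1r (x - a)) -scalerBl conjugateZ// xa.
rewrite ger0_norm; last by rewrite subr_ge0 ler_pdivrMr// mul1r.
rewrite mulrBl mul1r mulfVK ?gt_eqF//; lra.
Qed.

(* A point strictly inside a segment [a, a + s eta] whose far end is at
   distance [s] from [A] has [a] as its only nearest point: a second one would
   give equality in the triangle inequality at [a + s eta]. *)
Lemma dmn_proj_ray a eta s t : A a -> phi eta <= 1 -> 0 <= t < s ->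
  s <= d (a + s *: eta) -> dmn_proj F A (a + t *: eta).
Proof.
move=> Aa eta1 /andP[t0 ts] sd.
set x := a + t *: eta; have st : 0 < s - t by rewrite subr_gt0.
have far_le : phi ((s - t) *: eta) <= s - t.
  by rewrite conjugateZ// gtr0_norm// ler_piMr// ltW.
have xE b : a + s *: eta - b = (x - b) + (s - t) *: eta.
  by rewrite /x; apply/rowP => i; rewrite !mxE; ring.
have far_ge b : A b -> s <= phi ((x - b) + (s - t) *: eta).
  by move=> Ab; rewrite -xE (le_trans sd)// dist_le.
have t_le b : A b -> t <= phi (x - b).
  move=> Ab; have := far_ge b Ab.
  have := conjugateD F_C11 F_elliptic (x - b) ((s - t) *: eta); lra.
have xa : phi (x - a) = t.
  apply/eqP; rewrite eq_le t_le// andbT /x addrAC subrr add0r conjugateZ//.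
  by rewrite ger0_norm// ler_piMr.
have dx : d x = t.
  apply/eqP; rewrite eq_le; apply/andP; split.
    by rewrite -[leRHS]xa; exact: dist_le.
  by have [b /nearestE[Ab <-]] := nearest_exists x; exact: t_le.
exists a; split; first by apply/nearestE; rewrite xa dx.
move=> b /nearestE[Ab]; rewrite dx => xb.
(* [conjugate_strict] requires nonzero vectors, so the case where [x] is the foot [a] itself is
   separate. *)
have [tE0|tn0] := eqVneq t 0.
  have null w : phi w = t -> w = 0.
    move=> wt; apply/eqP/negPn/negP => /(conjugate_gt0 F_C11 F_elliptic).
    by rewrite wt tE0 ltxx.
  by move/eqP: (null _ xb); move/eqP: (null _ xa); rewrite !subr_eq0 => /eqP <- /eqP.
have tp : 0 < t by rewrite lt_neqAle eq_sym tn0.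
have far : phi ((s - t) *: eta) = s - t.
  apply/eqP; rewrite eq_le far_le /=; have := far_ge b Ab.
  have := conjugateD F_C11 F_elliptic (x - b) ((s - t) *: eta); rewrite xb; lra.
have nonzero w : 0 < phi w -> w != 0.
  by apply: contraTneq => ->; rewrite conjugate0// ltxx.
(* With the lengths [s - t] and [t] inserted, this reads [x - b = t *: eta], whence [b = a]. *)
have : phi ((s - t) *: eta) *: (x - b) = phi (x - b) *: ((s - t) *: eta).
  apply: (conjugate_strict F_C11 F_elliptic); [apply: nonzero..|].
  - by rewrite xb.
  - by rewrite far.
  apply/eqP; rewrite eq_le conjugateD//= xb far.
  by have := far_ge b Ab; lra.
rewrite far xb [RHS]scalerA mulrC -scalerA => /(scalerI (lt0r_neq0 st)).
by rewrite /x => /eqP; rewrite subr_eq addrC => /eqP /addrI.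
Qed.


Lemma dmn_proj_dist0 x : d x = 0 -> dmn_proj F A x.
Proof.
move=> dx; have uniq b : nearest F A x b -> x = b.
  move=> /nearestE[_ xb]; apply/eqP; rewrite -subr_eq0; apply/negPn/negP.
  by move=> /(conjugate_gt0 F_C11 F_elliptic); rewrite xb dx ltxx.
have [a xa] := nearest_exists x; exists a; split => // b /uniq <-.
by apply/esym/uniq.
Qed.

(* The value of [apsi] lies in this set exactly when its ray stops minimizing
   the distance to [A] before length [s]; the bound on the foot point is for
   compactness. *)
Definition short_rays (s K : R) : set (V * V) :=
  [set p | 0 < Num.min (s - d (p.1 + s *: p.2)) (K - phi p.1)].

Lemma short_raysE s K a eta :
  short_rays s K (a, eta) <-> d (a + s *: eta) < s /\ phi a < K.
Proof.
rewrite /short_rays /= lt_min !subr_gt0; split; first by case/andP.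
by case=> -> ->.
Qed.

(** The minimum in [short_rays] is Lipschitz for [edist2]: the first entry has constant
    [D * (1 + s)], the second [P], and their sum dominates both. *)
Lemma caratheodory_short_rays (k : nat) (s K : R) : 0 <= s ->
  (hausdorff edist2 k).-caratheodory (short_rays s K).
Proof.
move=> s0; have [D D0 dD] := dist_lipschitz.
have [P P0 phiP] := conjugate_lipschitz F_C11 F_elliptic.
apply: (@caratheodory_hausdorff_gt0 _ _ _ _ _ (D * (1 + s) + P)).
  by rewrite ltr_wpDl// mulr_ge0// ?ltW// ltr_wpDr.
move=> p q; have e1 := norm_fst_le_edist2 p q; have e2 := norm_snd_le_edist2 p q.
have h1 : (s - d (p.1 + s *: p.2)) - (s - d (q.1 + s *: q.2)) <=
    D * (1 + s) * edist2 p q.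
  have -> : s - d (p.1 + s *: p.2) - (s - d (q.1 + s *: q.2)) =
    d (q.1 + s *: q.2) - d (p.1 + s *: p.2) by ring.
  apply: le_trans (dD _ _) _; rewrite -mulrA ler_pM2l//.
  rewrite distrC opprD addrACA -scalerBr (le_trans (ler_normD _ _))//.
  by rewrite mulrDl mul1r lerD// normrZ ger0_norm// ler_wpM2l.
have h2 : (K - phi p.1) - (K - phi q.1) <= P * edist2 p q.
  have -> : K - phi p.1 - (K - phi q.1) = phi q.1 - phi p.1 by ring.
  by apply: le_trans (phiP _ _) _; rewrite ler_pM2l// distrC.
have E0 : 0 <= edist2 p q by exact: le_trans e1.
have DE : 0 <= D * (1 + s) * edist2 p q.
  by rewrite !mulr_ge0// ?ltW// ltr_wpDr.
have PE : 0 <= P * edist2 p q by rewrite mulr_ge0// ltW.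
rewrite mulrDl; move: h1 h2 DE PE.
rewrite /Num.min; case: ltP => ?; case: ltP => ? *; lra.
Qed.

Lemma caratheodory_unit_bundle (k : nat) :
  (hausdorff edist2 k).-caratheodory ([set: V] `*` frontier (wulff F 0 1)).
Proof.
have [P P0 phiP] := conjugate_lipschitz F_C11 F_elliptic.
have -> : [set: V] `*` frontier (wulff F 0 1) =
    ~` [set p : V * V | 0 < `|phi p.2 - 1|].
  rewrite frontier_wulff; apply/seteqP; split => -[a eta] /=.
    by case=> _ ->; rewrite subrr normr0 ltxx.
  by move=> /negP; rewrite normr_gt0 negbK subr_eq0 => /eqP.
apply: caratheodory_measurable_setC.
apply: (@caratheodory_hausdorff_gt0 _ _ _ _ (fun p => `|phi p.2 - 1|) _ P0) => p q.
apply: le_trans (lerB_dist _ _) _.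
have -> : phi p.2 - 1 - (phi q.2 - 1) = phi p.2 - phi q.2 by ring.
have e2 := norm_snd_le_edist2 p q.
apply: (@le_trans _ _ (P * `|p.2 - q.2|)); last by rewrite ler_pM2l.
have := phiP p.2 q.2; have := phiP q.2 p.2; rewrite (distrC q.2) => ? ?.
by rewrite ler_norml; apply/andP; split; lra.
Qed.

Lemma long_rays_compact (s K : R) : compact
  [set p : V * V | [/\ A p.1, phi p.1 <= K, phi p.2 <= 1 & s <= d (p.1 + s *: p.2)]].
Proof.
have -> : [set p : V * V | [/\ A p.1, phi p.1 <= K, phi p.2 <= 1
      & s <= d (p.1 + s *: p.2)]] =
    (fst @^-1` A `&` (fun p : V * V => d (p.1 + s *: p.2)) @^-1` [set t | s <= t])
    `&` ([set w : V | phi w <= K] `*` [set w : V | phi w <= 1]).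
  by apply/seteqP; split => -[a eta] /= [] // [] ? ? [].
rewrite setIC; apply: compact_closedI.
  by apply: compact_setX; exact: conjugate_ball_compact.
apply: closedI.
  by apply: closed_comp => // p _; exact: cvg_fst.
apply: (@closed_comp _ _ _ [set t | s <= t]) => [p _|]; last exact: closed_ge.
apply: (@continuous_comp _ _ _ (fun p : V * V => p.1 + s *: p.2) (fun y => d y)).
  by apply: cvgD; [exact: cvg_fst|apply: cvgZr; exact: cvg_snd].
exact: dist_continuous.
Qed.

(** This is a continuous image of a compact set of triples: foot, direction, length. Closedness
    gives a point off the long rays a whole neighbourhood off them. *)
Lemma long_rays_union_closed (s K : R) : closed
  ((fun p : (V * V) * R => p.1.1 + p.2 *: p.1.2) @`
   ([set p : V * V | [/\ A p.1, phi p.1 <= K, phi p.2 <= 1 &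
        s <= d (p.1 + s *: p.2)]] `*` [set` `[0, s]])).
Proof.
apply: compact_closed; first exact: norm_hausdorff.
apply: continuous_compact; last first.
  by apply: compact_setX; [exact: long_rays_compact|exact: segment_compact].
apply: continuous_subspaceT => p; apply: cvgD.
  by apply: (@continuous_comp _ _ _ fst fst); exact: cvg_fst.
apply: cvgZ; first exact: cvg_snd.
by apply: (@continuous_comp _ _ _ fst snd); [exact: cvg_fst|exact: cvg_snd].
Qed.

Lemma indic_short_rays_measurable (k : nat) (s K : R) : 0 <= s ->
  outer_measurable_on (hausdorff edist2 k)
    ([set: V] `*` frontier (wulff F 0 1)) (\1_(short_rays s K) : V * V -> R).
Proof.
move=> s0 Y mY; have mS := caratheodory_short_rays k K s0.
apply: caratheodory_measurable_setI; first exact: caratheodory_unit_bundle.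
(* A preimage under an indicator is everything, the set, its complement or empty. *)
rewrite preimage_indic; case: ifPn => _; case: ifPn => _ //.
- by rewrite -setC0; apply/caratheodory_measurable_setC/caratheodory_measurable_set0.
- exact: caratheodory_measurable_setC.
- exact: caratheodory_measurable_set0.
Qed.

Lemma indic_short_rays_compact_support (s K : R) :
  compact_support_on ([set: V] `*` frontier (wulff F 0 1))
    (\1_(short_rays s K) : V * V -> R).
Proof.
have cK : compact ([set w : V | phi w <= K] `*` [set w : V | phi w <= 1]).
  by apply: compact_setX; exact: conjugate_ball_compact.
apply: (subclosed_compact _ cK); first exact: closed_closure.
have clK := compact_closed (@norm_hausdorff _ _) cK.
rewrite [X in _ `<=` X](closure_id _).1//; apply: closure_subset.
move=> [a eta] [[_]]; rewrite frontier_wulff /= => eta1.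
rewrite indicE pnatr_eq0 eqb0 negbK inE => /short_raysE[_ /ltW aK].
by split => //=; rewrite eta1.
Qed.

(** The default [0] of [xget] never occurs since [nearest] is inhabited. The formula thus holds at
    every [x], even where several nearest points compete. *)
Lemma apsiE x : exists2 a, nearest F A x a & apsi F A x = (a, (d x)^-1 *: (x - a)).
Proof.
exists (aproj F A x) => //; have [a xa] := nearest_exists x.
exact: (xgetPex 0 (ex_intro _ a xa)).
Qed.

Lemma apsi_short_rays_far s K x : 0 < s <= d x -> ~ short_rays s K (apsi F A x).
Proof.
move=> sx; have [a xa ->] := apsiE x => /short_raysE[] h _.
by have := dist_ray xa sx; rewrite leNgt h.
Qed.

(* Otherwise the complement of the closed union of the long rays contains a box
   near [x], and the integrand is 1 on that box. *)
Lemma dmn_proj_of_null_short_rays (s : R) (x : V) :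
  0 < d x < s ->
  (forall K, (\int[lebesgue R n]_(y in ~` A)
     (\1_(short_rays s K) (apsi F A y) *
      \1_[set z | (adist F A z <= s%:E)%E] y)%:E = 0)%E) ->
  dmn_proj F A x.
Proof.
move=> /andP[dx0 dxs] null.
(* A foot [a] of [y] satisfies [phi a <= phi y + d y]; near [x] this is below [(phi x + 1) + s]. *)
pose K := phi x + 1 + s + 1.
set long := (fun p : (V * V) * R => p.1.1 + p.2 *: p.1.2) @`
   ([set p : V * V | [/\ A p.1, phi p.1 <= K, phi p.2 <= 1 &
        s <= d (p.1 + s *: p.2)]] `*` [set` `[0, s]]).
have [[[[a eta] t] [[/= Aa _ eta1 sd]]]|xlong] := pselect (long x).
  rewrite in_itv /= => /andP[t0 ts] xE; rewrite -xE.
  apply: (dmn_proj_ray Aa eta1 _ sd); rewrite t0 lt_neqAle ts andbT /=.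
  apply/eqP => tE; move: dxs; rewrite ltNge => /negP[].
  by rewrite -xE tE.
have open_pre (f : V -> R) (Y : set R) : continuous f -> open Y -> open (f @^-1` Y).
  by move=> cf; apply: open_comp => y _; exact: cf.
(* The four conditions keep the box off the long rays, outside [A], within the cutoff at [s], and
   with feet bounded by [K]. *)
have [|ab abW ab0] := @nbhs_box _ _ x
    (~` long `&` [set y | 0 < d y] `&` [set y | d y < s] `&` [set y | phi y < phi x + 1]).
  apply: open_nbhs_nbhs; split; last by split=> //; rewrite /= ltrDl.
  apply: openI; last by apply: (open_pre phi [set t | t < _]);
    [exact: conjugate_continuous|exact: open_lt].
  apply: openI; last by apply: (open_pre (fun y => d y) [set t | t < _]);
    [exact: dist_continuous|exact: open_lt].
  apply: openI; last by apply: (open_pre (fun y => d y) [set t | _ < t]);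
    [exact: dist_continuous|exact: open_gt].
  exact/closed_openC/long_rays_union_closed.
exfalso; move: ab0; rewrite -(null K) ltNge => /negP; apply.
apply: box_volume_le_integral => [y|y /abW[[[_ y0] _] _] Ay|y /abW[[[ylong y0] ys] yK]].
- by rewrite mulr_ge0.
- have := dist_le y Ay; rewrite subrr conjugate0// => y0'.
  by move: y0 => /=; rewrite ltNge y0'.
rewrite [X in _ * X]indicE mem_set ?mulr1; last by rewrite /= adistE lee_fin ltW.
have [a ya ->] := apsiE y.
rewrite indicE mem_set//; apply/short_raysE; have /nearestE[Aa yaE] := ya.
have aK : phi a < K.
  have -> : a = y + (a - y) by rewrite addrC subrK.
  apply: (le_lt_trans (conjugateD F_C11 F_elliptic _ _)).
  by rewrite (conjugateBC F_C11 F_elliptic a) yaE /K; move: ys yK => /= ys yK; lra.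
(* A ray that is not short would be long and carry [y] at length [d y < s]. *)
split => //; rewrite ltNge; apply/negP => sd; apply: ylong.
exists (a, (d y)^-1 *: (y - a), d y) => /=; last first.
  by rewrite scalerA divff ?gt_eqF// scale1r addrC subrK.
split; last by rewrite /= in_itv /= dist_ge0 ltW.
split => //=; first exact: ltW.
by rewrite conjugateZ// yaE ger0_norm ?invr_ge0 ?dist_ge0// mulVf// gt_eqF.
Qed.

End AnisotropicDistance.

(** * From the polynomial formula to the reach *)

Unset Implicit Arguments.

Theorem theorem5p9 (R : realType) (n : nat) (hn : (1 <= n)%N)
    (F : 'rV[R]_n.+1 -> R) (hF : integrand_C11 F) (hell : elliptic F)
    (A : set 'rV[R]_n.+1) (hA : closed A)
    (r : R) (hr : 0 < r)
    (hsteiner : forall f : 'rV[R]_n.+1 * 'rV[R]_n.+1 -> R,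
      let S := [set: 'rV[R]_n.+1] `*` frontier (wulff F 0 1) in
      outer_measurable_on (hausdorff edist2 n) S f ->
      bounded_values_on S f ->
      compact_support_on S f ->
      exists c : 'I_n.+1 -> R, forall t : R, 0 < t < r ->
        (\int[lebesgue R n]_(x in ~` A)
           (f (apsi F A x) * \1_[set y | (adist F A y <= t%:E)%E] x)%:E
         = (\sum_(j < n.+1) c j * t ^+ j.+1)%:E)%E) :
  (r%:E <= areach F A)%E.
Proof.
apply: ereal_sup_ubound; exists r => //= x xr.
(* For empty [A] the distance is [+oo], so no [x] lies within [r]. *)
have A0 : A !=set0.
  apply/set0P/eqP => A0; move: xr.
  by rewrite /= /adist A0 image_set0 ereal_inf0 ltNge leey.
move: xr; rewrite /= (adistE hF hell hA A0) lte_fin => xr.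
have [dx0|dx0] := eqVneq (fine (adist F A x)) 0; first exact: dmn_proj_dist0.
have {}dx0 : 0 < fine (adist F A x) by rewrite lt_neqAle eq_sym dx0 dist_ge0.
(* The midpoint is above [d x], so that [x] falls strictly inside a ray of length [s], and below
   [r], so that [[s, r)] is nondegenerate. *)
pose s := (fine (adist F A x) + r) / 2.
have s0 : 0 < s by rewrite /s; lra.
have sr : s < r by rewrite /s; lra.
apply: (dmn_proj_of_null_short_rays hF hell hA A0 (s := s)) => [|K].
  by rewrite dx0 /s /=; lra.
have [|||c cE] := hsteiner (\1_(short_rays F A s K)).
- by apply: indic_short_rays_measurable => //; exact: ltW.
- by exists 1 => p _; rewrite indicE; case: (_ \in _); rewrite ?normr1 ?normr0.
- exact: indic_short_rays_compact_support.
have sE : 0 < s < r by rewrite s0.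
rewrite cE//; congr _%:E; apply: (sum_monomials_constant (c := c) sr) => t /andP[st tr].
have tE : 0 < t < r by rewrite tr (lt_le_trans s0).
apply: EFin_inj; rewrite -(cE t tE) -(cE s sE).
apply: eq_integral => y _; congr _%:E.
have [ys|sy] := leP (fine (adist F A y)) s.
  congr (_ * _); rewrite !indicE !mem_set//= (adistE hF hell hA A0) lee_fin//.
  exact: le_trans st.
rewrite indicE memNset ?mul0r//; apply: apsi_short_rays_far => //.
by rewrite s0 ltW.
Qed.
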